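(* Let $\theta>0$ and $n\ge 2$. The spectrum of the matrix $M_n=((m_{ij}))_{1\le i,j\le n}$ with entries $$m_{ij}=\frac{\Theta(n-i-j)}{\big(ij\,\Theta(n-i)\Theta(n-j)\big)^{1/2}}-\Big(\frac{\Theta(n-i)}{i\,\Theta(n)}\Big)^{1/2}\Big(\frac{\Theta(n-j)}{j\,\Theta(n)}\Big)^{1/2}$$ comprises $$\mu_r=\frac{(-1)^r(r-1)!}{(\theta)_r},\qquad 1\le r\le n.$$ For the eigenvector corresponding to the maximal eigenvalue $\mu_2$, one may take the vector with coordinates $$\big((\theta+2)j-(2n+\theta)\big)\big(j\,\Theta(n-j)\big)^{1/2},\qquad 1\le j\le n.$$
   Context: For $m\in\{0,1,2,\dots\}$, $(x)_m=x(x+1)\cdots(x+m-1)$ (with $(x)_0=1$). $\Theta(m)=(\theta)_m/m!$ for integers $m\ge 0$, and $\Theta(-k)=0$ for integers $k\ge 1$. The spectrum is the full list $\{\mu_1,\dots,\mu_n\}$ of the $n$ eigenvalues of the real symmetric matrix $M_n$. *)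

(* Defs.v *)
From mathcomp Require Import all_boot all_order all_algebra.

Set Implicit Arguments.
Unset Strict Implicit.
Unset Printing Implicit Defensive.

Import GRing.Theory Num.Theory.

Local Open Scope ring_scope.

Definition rising (R : nzRingType) (x : R) (m : nat) : R :=
  \prod_(k < m) (x + k%:R).

Definition Theta (R : rcfType) (theta : R) (z : int) : R :=
  match z with
  | Posz m => rising theta m / (m`!)%:R
  | Negz _ => 0
  end.

(* The indices i and j are 1-based: they range over 1, ..., n. *)
Definition m_entry (R : rcfType) (theta : R) (n i j : nat) : R :=
  Theta theta (n%:Z - i%:Z - j%:Z)
    / Num.sqrt (i%:R * j%:R * Theta theta (n%:Z - i%:Z)
                            * Theta theta (n%:Z - j%:Z))
  - Num.sqrt (Theta theta (n%:Z - i%:Z) / (i%:R * Theta theta n%:Z))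
    * Num.sqrt (Theta theta (n%:Z - j%:Z) / (j%:R * Theta theta n%:Z)).

(* Ordinals count from 0, hence the successors. *)
Definition M_mx (R : rcfType) (theta : R) (n : nat) : 'M[R]_n :=
  \matrix_(i < n, j < n) m_entry theta n i.+1 j.+1.

(* Only meaningful for 1 <= r. *)
Definition mu (R : rcfType) (theta : R) (r : nat) : R :=
  (-1) ^+ r * (r.-1`!)%:R / rising theta r.

Definition v2_coord (R : rcfType) (theta : R) (n j : nat) : R :=
  ((theta + 2%:R) * j%:R - ((2 * n)%:R + theta))
    * Num.sqrt (j%:R * Theta theta (n%:Z - j%:Z)).

Definition v2 (R : rcfType) (theta : R) (n : nat) : 'cV[R]_n :=
  \col_(j < n) v2_coord theta n j.+1.

(* s lists all the eigenvalues of A, repeated according to their (algebraic)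
   multiplicity, in any order. *)
Definition is_spectrum (R : comNzRingType) (n : nat) (A : 'M[R]_n)
    (s : seq R) : Prop :=
  char_poly A = \prod_(a <- s) ('X - a%:P).

(* Column eigenvectors; [eigenspace] of mxalgebra is about row vectors. *)
Definition is_eigenvector (R : nzRingType) (n : nat) (A : 'M[R]_n) (a : R)
    (v : 'cV[R]_n) : Prop :=
  v != 0 /\ A *m v = a *: v.

(* Main.v *)
(** Conjugating [M_n] by the diagonal matrix with entries
    [d_j = (j Theta(n-j))^(1/2)] turns it into the operator
      [(K f)(i) = (L_(n-i) f / Theta(n-i) - L_n f / Theta(n)) / i],
    where [L_m f = \sum_(1 <= j <= m) Theta(m-j) f(j)].  On the rising factorial
    [f(j) = (j+1)_k] the Chu-Vandermonde convolution gives
    [L_m f / Theta(m) = k! ((theta+m)_(k+1) / (theta)_(k+1) - 1)], a polynomial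
    of degree [k+1] in [m]; hence [K f] is a polynomial of degree [k] in [i]
    whose leading coefficient is [(-1)^(k+1) k! / (theta)_(k+1)].  So [K] is
    triangular on polynomials, filtered by degree, with diagonal entries
    [mu_1, ..., mu_n], and the eigenvector for [mu_2] is the degree-one
    polynomial eigenfunction of [K]. *)

Require Import Defs.
From mathcomp Require Import all_boot all_order all_algebra.
From mathcomp Require Import ring.

Import Order.TTheory GRing.Theory Num.Theory.
Local Open Scope ring_scope.

(** * Rising factorials of numbers and of linear polynomials *)

Lemma risingS (R : nzRingType) (x : R) m :
  rising x m.+1 = rising x m * (x + m%:R).
Proof. by rewrite /rising big_ord_recr. Qed.

Lemma rising0 (R : nzRingType) (x : R) : rising x 0 = 1.
Proof. by rewrite /rising big_ord0. Qed.

Lemma rising_add (R : nzRingType) (x : R) m k :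
  rising x (m + k) = rising x m * rising (x + m%:R) k.
Proof.
elim: k => [|k IHk]; first by rewrite addn0 rising0 mulr1.
by rewrite addnS !risingS IHk natrD !mulrA addrA.
Qed.

Lemma rising_fact (R : nzRingType) m : rising (1 : R) m = m`!%:R.
Proof.
elim: m => [|m IHm]; first by rewrite rising0.
by rewrite risingS IHm nat1r factS mulnC natrM.
Qed.

Lemma rising_gt0 (R : rcfType) (x : R) m : 0 < x -> 0 < rising x m.
Proof. by move=> x0; apply: prodr_gt0 => i _; rewrite ltr_wpDr ?ler0n. Qed.

Lemma horner_rising (R : comNzRingType) (p : {poly R}) (x : R) m :
  (rising p m).[x] = rising p.[x] m.
Proof.
rewrite /rising horner_prod; apply: eq_bigr => i _.
by rewrite hornerD -polyC_natr hornerC.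
Qed.

(** Taking [a = 1] yields the monic basis [(j+1)_k]; taking [a = -1] yields its image under
    [kernel_op], and the sign in [mu]. *)
Lemma rising_linear (R : comNzRingType) (a b : R) m :
  (size (rising (a *: 'X + b%:P) m) <= m.+1)%N /\
  (rising (a *: 'X + b%:P) m)`_m = a ^+ m.
Proof.
elim: m => [|m [sz_m coef_m]]; first by rewrite rising0 size_poly1 coefC.
have -> : rising (a *: 'X + b%:P) m.+1 =
    a *: (rising (a *: 'X + b%:P) m * 'X)
    + (b + m%:R) *: rising (a *: 'X + b%:P) m.
  rewrite risingS -addrA -polyC_natr -polyCD mulrDr -scalerAr.
  by congr (_ + _); rewrite mulrC mul_polyC.
have sz_m2 : (size (rising (a *: 'X + b%:P) m) <= m.+2)%N by apply: leqW.
split.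
  apply: leq_trans (size_polyD _ _) _; rewrite geq_max.
  rewrite !(leq_trans (size_scale_leq _ _)) //.
  by apply: leq_trans (size_polyMleq _ _) _; rewrite size_polyX addn2.
rewrite coefD !coefZ coefMX /= coef_m (nth_default _ sz_m).
by rewrite mulr0 addr0 exprS.
Qed.

Local Arguments Theta : simpl never.

(** * Convolution and quotient identities for [Theta] *)

Section ThetaTheory.
Variable R : rcfType.
Implicit Types (a b theta : R).

Lemma fact_neq0 m : (m`!)%:R != 0 :> R.
Proof. by rewrite pnatr_eq0 -lt0n fact_gt0. Qed.

Lemma Theta_gt0 theta m : 0 < theta -> 0 < Theta theta m%:Z.
Proof. by move=> t0; rewrite divr_gt0 ?rising_gt0 // ltr0n fact_gt0. Qed.

Lemma ThetaS theta m :
  m.+1%:R * Theta theta m.+1%:Z = (theta + m%:R) * Theta theta m%:Z.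
Proof.
rewrite /Theta risingS factS natrM.
by field; rewrite fact_neq0 nat1r pnatr_eq0.
Qed.

(* Induction on [m]: multiply the sum by [m+1], split [m+1 = j + (m+1-j)] in
   each term, and absorb each factor with [ThetaS]. *)
Lemma Theta_convolution a b m :
  \sum_(j < m.+1) Theta a j%:Z * Theta b (m - j)%N%:Z = Theta (a + b) m%:Z.
Proof.
elim: m => [|m IHm].
  by rewrite big_ord_recl big_ord0 /Theta /= !rising0 !divr1 addr0 mulr1.
apply: (@mulfI _ m.+1%:R); first by rewrite pnatr_eq0.
rewrite ThetaS -IHm !mulr_sumr.
transitivity (\sum_(j < m.+2) (j%:R * Theta a j%:Z) * Theta b (m.+1 - j)%N%:Z
  + \sum_(j < m.+2) Theta a j%:Z * ((m.+1 - j)%:R * Theta b (m.+1 - j)%N%:Z)).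
  rewrite -big_split; apply: eq_bigr => j _ /=.
  have -> : m.+1%:R = j%:R + (m.+1 - j)%:R :> R.
    by rewrite -natrD subnKC // -ltnS.
  ring.
rewrite big_ord_recl [X in _ + X]big_ord_recr /= subnn !mul0r mulr0 add0r addr0.
rewrite -big_split; apply: eq_bigr => j _ /=.
have le_jm : (j <= m)%N by rewrite -ltnS.
rewrite /bump leq0n add1n subSS subSn // !ThetaS natrB //; ring.
Qed.

(** The factor [m!] cancels, and [(theta)_(m+k)] splits after [m] or after [k] factors. *)
Lemma Theta_shift theta k m : 0 < theta ->
  Theta (k%:R + theta) m%:Z / Theta theta m%:Z
    = rising (theta + m%:R) k / rising theta k.
Proof.
move=> t0; have mD := rising_add _ theta k m; rewrite addnC rising_add in mD.
have m0 := lt0r_neq0 (rising_gt0 _ theta m t0).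
have k0 := lt0r_neq0 (rising_gt0 _ theta k t0).
have -> : rising (theta + m%:R) k
    = rising theta k * rising (theta + k%:R) m / rising theta m.
  by rewrite -mD mulrAC divff // mul1r.
by rewrite /Theta [k%:R + _]addrC; field; rewrite m0 k0 fact_neq0.
Qed.

(** Both sides are the binomial coefficient [(k+j)! / (k! j!)]. This makes the basis polynomial
    [(j+1)_k] accessible to [Theta_convolution]. *)
Lemma Theta_rising k j : Theta k.+1%:R j%:Z = rising (1 + j%:R) k / k`!%:R :> R.
Proof.
have := rising_add _ (1 : R) k j; rewrite addnC rising_add.
rewrite !rising_fact [1 + k%:R]nat1r.
rewrite /Theta => E; apply/eqP; rewrite eqr_div ?fact_neq0 //.
by rewrite mulrC -E mulrC.
Qed.

End ThetaTheory.

(** * The conjugated operator and its action on polynomials *)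

Section Operator.
Variables (R : rcfType) (theta : R) (n : nat).
Hypothesis theta_gt0 : 0 < theta.
Implicit Types (f g : nat -> R) (p : {poly R}).

(* For [m <= n] the terms with [m < j] vanish, as [Theta] is [0] at negative
   integers. *)
Definition conv m f : R :=
  \sum_(j < n) Theta theta (m%:Z - j.+1%:Z) * f j.+1.

Definition kernel_op f i : R :=
  (conv (n - i) f / Theta theta (n - i)%N%:Z - conv n f / Theta theta n%:Z)
    / i%:R.

Lemma conv_linear m c f g :
  conv m (fun j => c * f j + g j) = c * conv m f + conv m g.
Proof.
rewrite /conv mulr_sumr -big_split; apply: eq_bigr => j _ /=; ring.
Qed.

Lemma kernel_op_linear c f g i :
  kernel_op (fun j => c * f j + g j) i = c * kernel_op f i + kernel_op g i.
Proof. rewrite /kernel_op !conv_linear; ring. Qed.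

Lemma eq_kernel_op f g i : f =1 g -> kernel_op f i = kernel_op g i.
Proof.
by move=> fg; rewrite /kernel_op /conv; congr ((_ / _ - _ / _) / _);
  apply: eq_bigr => j _; rewrite fg.
Qed.

Lemma kernel_op0 i : kernel_op (fun=> 0) i = 0.
Proof.
rewrite /kernel_op /conv.
by rewrite !big1 ?mul0r ?subrr ?mul0r // => j _; rewrite mulr0.
Qed.

(** Chu-Vandermonde; the subtracted term is the summand at index 0, which [conv] omits. *)
Lemma conv_Theta a m : (m <= n)%N ->
  conv m (fun j => Theta a j%:Z) = Theta (a + theta) m%:Z - Theta theta m%:Z.
Proof.
move=> le_mn; rewrite -Theta_convolution big_ord_recl /= subn0.
have -> : Theta a 0 = 1 by rewrite /Theta /= rising0 divr1.
rewrite mul1r [X in X - _]addrC addrK.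
rewrite [RHS](big_ord_widen n
  (fun j => Theta a j.+1%:Z * Theta theta (m - j.+1)%N%:Z) le_mn).
rewrite [RHS]big_mkcond; apply: eq_bigr => j _; case: ltnP => [lt_jm|le_mj].
  by rewrite subzn // mulrC.
have -> : m%:Z - j.+1%:Z = Negz (j - m).
  by rewrite NegzE -subSn // -subzn ?leqW // opprB.
by rewrite mul0r.
Qed.

(** The two quotients in [kernel_op] each contribute a constant [-1] from [conv_Theta], and these
    cancel. *)
Lemma kernel_op_rising k i : (0 < i <= n)%N ->
  kernel_op (fun j => rising (1 + j%:R) k) i
    = k`!%:R / rising theta k.+1
      * ((rising (theta + n%:R - i%:R) k.+1 - rising (theta + n%:R) k.+1)
         / i%:R).
Proof.
case/andP=> i_gt0 le_in.
have T0 m : Theta theta m%:Z != 0 by rewrite lt0r_neq0 // Theta_gt0.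
rewrite (@eq_kernel_op _ (fun j => k`!%:R * Theta k.+1%:R j%:Z + 0));
  last by move=> j; rewrite addr0 Theta_rising mulrC divfK ?fact_neq0.
rewrite (kernel_op_linear _ _ (fun=> 0)).
rewrite kernel_op0 addr0 /kernel_op !conv_Theta ?leq_subr //.
rewrite ![(_ - Theta theta _) / _]mulrBl !divff // !Theta_shift // natrB //.
rewrite addrA; ring.
Qed.

Lemma kernel_op_poly k p : (size p <= k)%N ->
  exists q : {poly R}, [/\ (size q <= k)%N, q`_k.-1 = mu theta k * p`_k.-1 &
    forall i, (0 < i <= n)%N -> kernel_op (fun j => p.[j%:R]) i = q.[i%:R]].
Proof.
have basis m : exists q : {poly R}, [/\ (size q <= m.+1)%N,
    q`_m = mu theta m.+1 &
    forall i, (0 < i <= n)%N ->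
      kernel_op (fun j => rising (1 + j%:R) m) i = q.[i%:R]].
  (* The numerator in [kernel_op_rising] is [g(i) - g(0)], so dividing by [i] amounts to dropping
     the constant term of [g] and shifting the coefficients down. *)
  pose g := rising (-1 *: 'X + (theta + n%:R)%:P) m.+1.
  have [sz_g coef_g] := rising_linear _ (-1) (theta + n%:R) m.+1.
  rewrite -/g in sz_g coef_g.
  have gE x : g.[x] = rising (theta + n%:R - x) m.+1.
    by rewrite horner_rising hornerD hornerZ hornerX hornerC mulN1r addrC.
  exists ((m`!%:R / rising theta m.+1) *: drop_poly 1 g); split.
  - apply: leq_trans (size_scale_leq _ _) _.
    by rewrite size_drop_poly leq_subLR add1n.
  - rewrite coefZ coef_drop_poly addn1 coef_g /mu /=; ring.
  move=> i i_n; rewrite kernel_op_rising // hornerZ; congr (_ * _).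
  have i0 : i%:R != 0 :> R by rewrite pnatr_eq0 -lt0n; case/andP: i_n.
  apply: (mulIf i0); rewrite divfK // -gE -[theta + n%:R]subr0 -gE.
  rewrite -{1}(poly_take_drop 1 g) hornerD hornerM hornerXn expr1.
  have -> : (take_poly 1 g).[i%:R] = g.[0].
    rewrite (@horner_coef_wide _ 1) ?size_take_poly // big_ord1 expr0 mulr1.
    by rewrite coef_take_poly /= horner_coef0.
  by rewrite addrAC subrr add0r.
elim: k p => [|k IHk] p sz_p.
  (* For [k = 0] the value [mu theta 0] is a junk value, harmless since [p] vanishes. *)
  have -> : p = 0 by apply/eqP; rewrite -size_poly_leq0.
  exists 0; split; rewrite ?size_poly0 ?coef0 ?mulr0 // => i _.
  by rewrite (@eq_kernel_op _ (fun=> 0)) ?kernel_op0 ?horner0 // => j;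
    rewrite horner0.
have [q [sz_q coef_q qE]] := basis k.
have [sz_b coef_b] := rising_linear _ (1 : R) 1 k.
set b := rising _ _ in sz_b coef_b; rewrite expr1n in coef_b.
have bE x : b.[x] = rising (1 + x) k.
  by rewrite horner_rising hornerD hornerZ hornerX hornerC mul1r addrC.
(* As [b] is monic of degree [k], the subtraction cancels the top coefficient of [p]. *)
have sz_p' : (size (p - p`_k *: b)%R <= k)%N.
  apply/leq_sizeP => j; rewrite leq_eqVlt => /predU1P[<-|lt_kj].
    by rewrite coefB coefZ coef_b mulr1 subrr.
  rewrite coefB coefZ [p`_j]nth_default ?[b`_j]nth_default ?mulr0 ?subr0 //.
    exact: leq_trans sz_b lt_kj.
  exact: leq_trans sz_p lt_kj.
have [q' [sz_q' _ q'E]] := IHk _ sz_p'.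
exists (p`_k *: q + q'); split.
- apply: leq_trans (size_polyD _ _) _; rewrite geq_max.
  by rewrite (leq_trans (size_scale_leq _ _)) //= leqW.
- by rewrite coefD coefZ coef_q (nth_default _ sz_q') addr0 mulrC.
move=> i i_n; rewrite hornerD hornerZ -qE // -q'E // -kernel_op_linear.
by apply: eq_kernel_op => j; rewrite -bE !hornerE /=; ring.
Qed.

Definition weight j : R := Num.sqrt (j%:R * Theta theta (n%:Z - j%:Z)).

Lemma weight_gt0 j : (0 < j <= n)%N -> 0 < weight j.
Proof.
case/andP=> j_gt0 le_jn.
by rewrite sqrtr_gt0 mulr_gt0 ?ltr0n // subzn // Theta_gt0.
Qed.

(** Entrywise conjugation by the weights: every square root becomes a rational expression in the two
    weights and the root of [Theta(n)], leaving a field identity. *)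
Lemma m_entry_weight i j : (0 < i <= n)%N -> (0 < j <= n)%N ->
  m_entry theta n i j * weight j = weight i *
    ((Theta theta ((n - i)%N%:Z - j%:Z) / Theta theta (n - i)%N%:Z
      - Theta theta (n%:Z - j%:Z) / Theta theta n%:Z) / i%:R).
Proof.
move=> i_n j_n.
have [[i_gt0 le_in] [j_gt0 le_jn]] := (andP i_n, andP j_n).
have T0 m : 0 < Theta theta m%:Z := Theta_gt0 _ theta m theta_gt0.
have s_gt0 : 0 < Num.sqrt (Theta theta n%:Z) by rewrite sqrtr_gt0.
have sE : Num.sqrt (Theta theta n%:Z) ^+ 2 = Theta theta n%:Z.
  by rewrite sqr_sqrtr // ltW.
have wE k : (0 < k <= n)%N -> weight k ^+ 2 = k%:R * Theta theta (n - k)%N%:Z.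
  case/andP=> k_gt0 le_kn; rewrite /weight subzn // sqr_sqrtr //.
  by rewrite mulr_ge0 ?ler0n // ltW.
have ratioE k : (0 < k <= n)%N ->
    Num.sqrt (Theta theta (n - k)%N%:Z / (k%:R * Theta theta n%:Z))
    = Theta theta (n - k)%N%:Z / (weight k * Num.sqrt (Theta theta n%:Z)).
  move=> k_n; have w_gt0 := weight_gt0 k k_n.
  have k0 : k%:R != 0 :> R by rewrite pnatr_eq0 -lt0n; case/andP: k_n.
  have r_ge0 := divr_ge0 (ltW (T0 (n - k)%N)) (ltW (mulr_gt0 w_gt0 s_gt0)).
  rewrite -[RHS](ger0_norm r_ge0) -sqrtr_sqr; congr Num.sqrt.
  rewrite expr_div_n [(weight k * _) ^+ 2]exprMn sE wE //.
  by field; rewrite k0 !lt0r_neq0.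
rewrite /m_entry (subzn le_in) (subzn le_jn) !ratioE //.
have -> : i%:R * j%:R * Theta theta (n - i)%N%:Z * Theta theta (n - j)%N%:Z
    = (weight i * weight j) ^+ 2 by rewrite exprMn !wE //; ring.
rewrite sqrtr_sqr ger0_norm; last by rewrite mulr_ge0 // ltW // weight_gt0.
have wi0 := lt0r_neq0 (weight_gt0 i i_n).
have wj0 := lt0r_neq0 (weight_gt0 j j_n).
have s0 := lt0r_neq0 s_gt0.
have i0 : i%:R != 0 :> R by rewrite pnatr_eq0 -lt0n.
have TiE : Theta theta (n - i)%N%:Z = weight i ^+ 2 / i%:R.
  by rewrite wE // mulrAC divff // mul1r.
move: (Num.sqrt _) s0 sE => s s0 sE; rewrite TiE -sE; field.
by rewrite wi0 wj0 s0 i0.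
Qed.

Lemma M_mx_weight f :
  M_mx theta n *m (\col_j (weight j.+1 * f j.+1))
    = \col_i (weight i.+1 * kernel_op f i.+1).
Proof.
apply/colP => i; rewrite !mxE.
transitivity (\sum_(j < n) weight i.+1 *
  ((Theta theta ((n - i.+1)%N%:Z - j.+1%:Z) / Theta theta (n - i.+1)%N%:Z
      - Theta theta (n%:Z - j.+1%:Z) / Theta theta n%:Z) / i.+1%:R * f j.+1)).
  apply: eq_bigr => j _; rewrite !mxE mulrA.
  by rewrite m_entry_weight ?ltn_ord // -mulrA.
rewrite -mulr_sumr; congr (_ * _).
rewrite /kernel_op /conv mulr_suml [X in _ - X]mulr_suml -sumrB mulr_suml.
by apply: eq_bigr => j _ /=; ring.
Qed.

Lemma M_mx_v2 : M_mx theta n *m v2 theta n = mu theta 2 *: v2 theta n.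
Proof.
pose w j : R := (theta + 2%:R) * j%:R - ((2 * n)%:R + theta).
have t0 := lt0r_neq0 theta_gt0.
have t1 : theta + 1 != 0 by rewrite lt0r_neq0 // addr_gt0.
have v2E : v2 theta n = \col_j (weight j.+1 * w j.+1).
  by apply/colP => j; rewrite !mxE mulrC.
rewrite v2E (M_mx_weight w); apply/colP => i; rewrite !mxE [RHS]mulrCA.
congr (_ * _).
have i_n : (0 < i.+1 <= n)%N by rewrite ltn_ord.
(* [b] is the constant left when [w] is expanded in the basis [(j+1)_1], [(j+1)_0]. *)
pose b := - (theta + 2%:R) - ((2 * n)%:R + theta).
rewrite (eq_kernel_op w (fun j => (theta + 2%:R) * rising (1 + j%:R) 1
  + (b * rising (1 + j%:R) 0 + 0))); last first.
  move=> j; rewrite risingS !rising0 /w /b; ring.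
rewrite kernel_op_linear (kernel_op_linear b _ (fun=> 0)) !kernel_op_rising //.
rewrite kernel_op0.
have i0 : i.+1%:R != 0 :> R by rewrite pnatr_eq0.
rewrite /mu /w /b !risingS !rising0 natrM; field.
by rewrite nat1r i0 t0 t1.
Qed.

End Operator.

(** * Spectrum and maximal eigenvalue *)

(** [B] also intertwines the characteristic matrices, and its determinant cancels. The transpose
    appears because [is_trig_mx] means lower triangular. *)
Lemma charpoly_similar_trig (F : fieldType) (n : nat) (A B T : 'M[F]_n) :
  \det B != 0 -> is_trig_mx T -> A *m B = B *m T^T ->
  char_poly A = \prod_(i < n) ('X - (T i i)%:P).
Proof.
move=> B0 trigT AB; rewrite -char_poly_trig //.
have B'0 : \det (map_mx polyC B) != 0 by rewrite det_map_mx polyC_eq0.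
apply: (mulIf B'0); rewrite -det_mulmx.
have -> : char_poly_mx A *m map_mx polyC B
    = map_mx polyC B *m (char_poly_mx T)^T.
  rewrite /char_poly_mx linearB /= tr_scalar_mx map_trmx mulmxBl mulmxBr.
  by rewrite -!map_mxM AB scalar_mxC.
by rewrite det_mulmx det_tr mulrC.
Qed.

Lemma M_mx_spectrum (R : rcfType) (theta : R) (n : nat) : 0 < theta ->
  is_spectrum (M_mx theta n) [seq mu theta r | r <- index_iota 1 n.+1].
Proof.
move=> theta_gt0; rewrite /is_spectrum big_map big_add1 /= big_mkord.
have /fin_all_exists [q qP] (k : 'I_n) := kernel_op_poly R theta n theta_gt0
  k.+1 'X^k (eq_leq (size_polyXn R k)).
(* Column [j] of [B] is the weighted monomial of degree [j] at the nodes [1, ..., n]; row [i] of [T]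
   holds the coefficients of the image of ['X^i]. *)
pose B : 'M[R]_n := \matrix_(i, j) (weight R theta n i.+1 * i.+1%:R ^+ j).
pose T : 'M[R]_n := \matrix_(i, j) (q i)`_j.
have diagT i : T i i = mu theta i.+1.
  by have [_ + _] := qP i; rewrite mxE /= => ->; rewrite coefXn eqxx mulr1.
under eq_bigr do rewrite -diagT.
apply: (@charpoly_similar_trig _ _ _ B).
(* [B] is invertible: positive weights times a Vandermonde matrix with distinct nodes. *)
- have -> : B = diag_mx (\row_i weight R theta n i.+1)
                *m (Vandermonde n (\row_i i.+1%:R))^T.
    by apply/matrixP => i j; rewrite mul_diag_mx !mxE.
  rewrite det_mulmx det_diag det_tr det_Vandermonde mulf_neq0 //.
    by apply/prodf_neq0 => i _; rewrite mxE lt0r_neq0 // weight_gt0 ?ltn_ord.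
  apply/prodf_neq0 => i _; apply/prodf_neq0 => j lt_ij.
  by rewrite !mxE subr_eq0 eqr_nat eqSS gtn_eqF.
- apply/is_trig_mxP => i j lt_ij; rewrite mxE.
  by have [sz_q _ _] := qP i; rewrite nth_default // (leq_trans sz_q).
apply/matrixP => i k; have [sz_q _ qE] := qP k.
have /colP/(_ i) := M_mx_weight R theta n theta_gt0 (fun j => ('X^k).[j%:R]).
rewrite !mxE qE ?ltn_ord // => E.
transitivity (weight R theta n i.+1 * (q k).[i.+1%:R]).
  by rewrite -E; apply: eq_bigr => j _; rewrite !mxE hornerXn.
rewrite (horner_coef_wide _ (leq_trans sz_q (ltn_ord k))) mulr_sumr.
by apply: eq_bigr => j _; rewrite !mxE mulrCA mulrC.
Qed.

(** [mu_1] is negative. For larger indices absolute values suffice: the factors [theta + k] with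
    [k >= 2] dominate those of [(r-1)!]. *)
Lemma mu_le_mu2 (R : rcfType) (theta : R) r : 0 < theta -> (0 < r)%N ->
  mu theta r <= mu theta 2.
Proof.
move=> t_gt0; have -> : mu theta 2 = (rising theta 2)^-1.
  by rewrite /mu sqrrN expr1n !mul1r.
case: r => [//|[_|r _]].
  apply: (@le_trans _ _ 0); last by rewrite invr_ge0 ltW // rising_gt0.
  by rewrite /mu expr1 mulr1 mulN1r oppr_le0 invr_ge0 ltW // rising_gt0.
have rising_ge : rising theta 2 * (r.+1`!)%:R <= rising theta r.+2.
  elim: r => [|r IHr]; first by rewrite mulr1.
  rewrite [rising theta r.+3]risingS factS natrM mulrCA mulrC.
  apply: ler_pM => //; rewrite ?mulr_ge0 ?ler0n //.
    by rewrite ltW // rising_gt0.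
  by rewrite lerDr ltW.
apply: le_trans (ler_norm _) _.
rewrite /mu normrM normfV normrM normrX normrN1 expr1n mul1r normr_nat.
rewrite gtr0_norm ?rising_gt0 // ler_pdivrMr ?rising_gt0 //.
by rewrite mulrC ler_pdivlMr ?rising_gt0 // mulrC.
Qed.

Theorem theorem2 (R : rcfType) (theta : R) (n : nat)
    (theta_gt0 : 0 < theta) (n_ge2 : (2 <= n)%N) :
  [/\ is_spectrum (M_mx theta n) [seq mu theta r | r <- index_iota 1 n.+1],
      eigenvalue (M_mx theta n) (mu theta 2)
        /\ (forall a : R, eigenvalue (M_mx theta n) a -> a <= mu theta 2)
    & is_eigenvector (M_mx theta n) (mu theta 2) (v2 theta n)].
Proof.
have specM := M_mx_spectrum R theta n theta_gt0.
have eigE a : eigenvalue (M_mx theta n) a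
    = (a \in [seq mu theta r | r <- index_iota 1 n.+1]).
  by rewrite eigenvalue_root_char specM root_prod_XsubC.
split=> //; [split | split; last exact: M_mx_v2].
- by rewrite eigE map_f // mem_index_iota ltnS.
- move=> a; rewrite eigE => /mapP[r].
  rewrite mem_index_iota => /andP[r_gt0 _] ->; exact: mu_le_mu2.
(* The coordinate at [j = 1] is [2(1 - n)] times a positive weight, hence nonzero. *)
apply/eqP => /colP/(_ (Ordinal (ltnW n_ge2))) /eqP.
rewrite !mxE /v2_coord -/(weight R theta n 1) mulf_eq0.
rewrite (negPf (lt0r_neq0 (weight_gt0 _ _ _ theta_gt0 _ _))) ?(ltnW n_ge2) //.
have -> : (theta + 2) * 1 - ((2 * n)%:R + theta) = 2 * (1 - n%:R) :> R.
  by rewrite natrM; ring.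
rewrite orbF mulf_eq0 pnatr_eq0 subr_eq0.
by rewrite [1 == _]eq_sym pnatr_eq1 [n == _]gtn_eqF.
Qed.
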